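(* Let $\psi:M^m\to\bar M^{n+1}=I\times_hP$ be a mean curvature flow soliton with respect to $X=h(t)\partial_t$, with constant $c$, and $M$ connected. Suppose that for some $\chi\in C^1(\mathbb R)$ with $\chi\ge0$ on $\hat\eta(I)$, the function $\hat\eta(t)=\int_{t_0}^th(s)\,ds$ satisfies the differential equation $$\hat\eta'=\chi(\hat\eta)^{1/2}\quad\text{on } I.$$ Then there exists a constant $C\in\mathbb R$ such that $$|\mathbf H|^2+c^2|\nabla\eta|^2-c^2\chi(\eta)=C\quad\text{on }M,$$ where $\eta(x)=\hat\eta((\pi\circ\psi)(x))$, $x\in M$.
   Context: $I\subset\mathbb R$ is an open interval, $t_0\in I$ is fixed, $h:I\to(0,\infty)$ is smooth, $(P^n,g_0)$ is a Riemannian manifold, and $\bar M^{n+1}=I\times_hP$ is $I\times P$ with metric $dt^2+h(t)^2g_0$; $\pi(t,p)=t$. An isometric immersion $\psi:M^m\to\bar M^{n+1}$ is a mean curvature flow soliton with respect to $X$ if $c\,X^\perp=\mathbf H$ along $\psi$ for some constant $c\in\mathbb R$, where $\perp$ is projection on the normal bundle and $\mathbf H$ is the non-normalized mean curvature vector (the trace of the second fundamental form). *)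

(* Defs.v *)
From HB Require Import structures.
From mathcomp Require Import all_boot all_order all_algebra.
From mathcomp Require Import all_classical all_reals all_analysis.

Set Implicit Arguments.
Unset Strict Implicit.
Unset Printing Implicit Defensive.

Import Order.TTheory GRing.Theory Num.Theory.
Import numFieldNormedType.Exports.

Local Open Scope classical_set_scope.
Local Open Scope ring_scope.

Definition partial (R : realType) (m : nat) (i : 'I_m) (f : 'rV[R]_m -> R) :
    'rV[R]_m -> R :=
  fun u => 'D_(delta_mx 0 i) f u.

(* U is open wherever Ck and smooth_map are used. *)
Fixpoint Ck (R : realType) (m : nat) (k : nat) (U : set 'rV[R]_m)
    (f : 'rV[R]_m -> R) : Prop :=
  (forall u, U u -> {for u, continuous f}) /\
  if k is k'.+1 then
    forall i : 'I_m, (forall u, U u -> derivable f u (delta_mx 0 i)) /\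
                     Ck k' U (partial i f)
  else True.

Definition smooth_fun (R : realType) (m : nat) (U : set 'rV[R]_m)
    (f : 'rV[R]_m -> R) : Prop :=
  forall k : nat, Ck k U f.

Definition smooth_map (R : realType) (m n : nat) (U : set 'rV[R]_m)
    (F : 'rV[R]_m -> 'rV[R]_n) : Prop :=
  forall j : 'I_n, smooth_fun U (fun u => F u 0 j).

(* Tangent vectors are row vectors, so the differential acts on the right:
   row i of the matrix is the image of the i-th coordinate vector. *)
Definition jac (R : realType) (m n : nat) (F : 'rV[R]_m -> 'rV[R]_n)
    (u : 'rV[R]_m) : 'M[R]_(m, n) :=
  \matrix_(i, j) partial i (fun v => F v 0 j) u.

(* [param] is the inverse of [coord]; its values outside [coord @` dom] are
   irrelevant. *)
Record chart (R : realType) (T : topologicalType) (n : nat) := Chart {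
  dom : set T;
  coord : T -> 'rV[R]_n;
  param : 'rV[R]_n -> T
}.

Definition is_chart (R : realType) (T : topologicalType) (n : nat)
    (a : chart R T n) : Prop :=
  [/\ open (dom a), open (coord a @` dom a),
      forall p, dom a p -> param a (coord a p) = p,
      forall p, dom a p -> {for p, continuous (coord a)} &
      forall p, dom a p -> {for coord a p, continuous (param a)}].

(* The tangent space at p is identified with 'rV_n through the preferred
   chart [chart_at p], and [metric p] is the Gram matrix of the inner product
   in this identification. *)
Record riemannian (R : realType) (n : nat) := Riemannian {
  space :> topologicalType;
  atlas : set (chart R space n);
  chart_at : space -> chart R space n;
  metric : space -> 'M[R]_n
}.

Arguments atlas {R n} r _.

Definition transition (R : realType) (T : topologicalType) (n : nat)
    (a b : chart R T n) : 'rV[R]_n -> 'rV[R]_n :=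
  fun u => coord b (param a u).

(* The coefficients g_ij of the metric in the chart a, as functions of the
   coordinates. *)
Definition local_metric (R : realType) (n : nat) (N : riemannian R n)
    (a : chart R N n) (u : 'rV[R]_n) : 'M[R]_n :=
  let p := param a u in
  let J := jac (transition a (chart_at p)) u in
  J *m metric p *m J^T.

Definition inner (R : realType) (n : nat) (g : 'M[R]_n) (v w : 'rV[R]_n) : R :=
  (v *m g *m w^T) 0 0.

Record is_riemannian_manifold (R : realType) (n : nat) (N : riemannian R n) :
    Prop := IsRiemannianManifold {
  manifold_hausdorff : hausdorff_space N;
  manifold_second_countable : @second_countable N;
  manifold_chart : forall a, atlas N a -> is_chart a;
  manifold_chart_at :
    forall p : N, atlas N (chart_at p) /\ dom (chart_at p) p;
  manifold_transition : forall a b, atlas N a -> atlas N b ->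
    smooth_map (coord a @` (dom a `&` dom b)) (transition a b);
  metric_sym : forall p : N, (metric p)^T = metric p;
  metric_posdef :
    forall (p : N) (v : 'rV[R]_n), v != 0 -> 0 < inner (metric p) v v;
  metric_smooth : forall a, atlas N a -> forall i j : 'I_n,
    smooth_fun (coord a @` dom a) (fun u => local_metric a u i j)
}.

Definition warped_chart (R : realType) (I : set R) (t0 : I) (n : nat)
    (T : topologicalType) (a : chart R T n) :
    chart R (set_type I * T)%type (1 + n) :=
  {| dom := [set q : (set_type I * T)%type | dom a q.2];
     coord := fun q : (set_type I * T)%type => row_mx (\val q.1)%:M (coord a q.2);
     param := fun u => (insubd t0 (lsubmx u 0 0), param a (rsubmx u)) |}.

(* t0 only supplies a value for [param] outside the image of a chart. *)
Definition warped_product (R : realType) (I : set R) (t0 : I) (h : R -> R)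
    (n : nat) (P : riemannian R n) : riemannian R (1 + n) :=
  {| space := (set_type I * P)%type;
     atlas := [set warped_chart t0 a | a in atlas P];
     chart_at := fun q : (set_type I * P)%type => warped_chart t0 (chart_at q.2);
     metric := fun q : (set_type I * P)%type =>
       block_mx 1%:M 0 0 (h (\val q.1) ^+ 2 *: metric q.2) |}.

(* Levi-Civita connection of N at p, in the chart [chart_at p]. *)
Definition christoffel (R : realType) (n : nat) (N : riemannian R n) (p : N)
    (a b c : 'I_n) : R :=
  let u := coord (chart_at p) p in
  let g := local_metric (chart_at p) in
  let dg (i j k : 'I_n) := partial i (fun v => g v j k) u in
  2^-1 * \sum_(d < n) invmx (g u) c d * (dg a b d + dg b a d - dg d a b).

Definition smooth_between (R : realType) (m n : nat) (M : riemannian R m)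
    (N : riemannian R n) (psi : M -> N) : Prop :=
  continuous psi /\
  forall a b, atlas M a -> atlas N b ->
    smooth_map (coord a @` (dom a `&` psi @^-1` dom b))
      (fun u => coord b (psi (param a u))).

Definition local_rep (R : realType) (m n : nat) (M : riemannian R m)
    (N : riemannian R n) (psi : M -> N) (x : M) : 'rV[R]_m -> 'rV[R]_n :=
  fun u => coord (chart_at (psi x)) (psi (param (chart_at x) u)).

Definition dmap (R : realType) (m n : nat) (M : riemannian R m)
    (N : riemannian R n) (psi : M -> N) (x : M) : 'M[R]_(m, n) :=
  jac (local_rep psi x) (coord (chart_at x) x).

Record isometric_immersion (R : realType) (m n : nat) (M : riemannian R m)
    (N : riemannian R n) (psi : M -> N) : Prop := IsometricImmersion {
  immersion_smooth : smooth_between psi;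
  immersion_injective : forall x : M, row_free (dmap psi x);
  immersion_isometric : forall (x : M) (v w : 'rV[R]_m),
    inner (metric (psi x)) (v *m dmap psi x) (w *m dmap psi x) =
    inner (metric x) v w
}.

(* Orthogonal projection of T_(psi x) N onto the row space of dmap psi x
   (the tangent space of M), by the Gram matrix of the rows. *)
Definition tangent_part (R : realType) (m n : nat) (M : riemannian R m)
    (N : riemannian R n) (psi : M -> N) (x : M) (v : 'rV[R]_n) : 'rV[R]_n :=
  let D := dmap psi x in
  let g := metric (psi x) in
  v *m g *m D^T *m invmx (D *m g *m D^T) *m D.

Definition normal_part (R : realType) (m n : nat) (M : riemannian R m)
    (N : riemannian R n) (psi : M -> N) (x : M) (v : 'rV[R]_n) : 'rV[R]_n :=
  v - tangent_part psi x v.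

(* The ambient covariant derivative of d psi(e_j) along e_i at x, for the
   coordinate fields e_i, e_j of [chart_at x]. *)
Definition ambient_derivative (R : realType) (m n : nat) (M : riemannian R m)
    (N : riemannian R n) (psi : M -> N) (x : M) (i j : 'I_m) : 'rV[R]_n :=
  let u := coord (chart_at x) x in
  let D := dmap psi x in
  \row_c (partial i (partial j (fun v => local_rep psi x v 0 c)) u +
          \sum_(a < n) \sum_(b < n)
            christoffel (psi x) a b c * D i a * D j b).

Definition second_fundamental_form (R : realType) (m n : nat)
    (M : riemannian R m) (N : riemannian R n) (psi : M -> N) (x : M)
    (i j : 'I_m) : 'rV[R]_n :=
  normal_part psi x (ambient_derivative psi x i j).

Definition mean_curvature (R : realType) (m n : nat) (M : riemannian R m)
    (N : riemannian R n) (psi : M -> N) (x : M) : 'rV[R]_n :=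
  \sum_(i < m) \sum_(j < m)
    invmx (metric x) i j *: second_fundamental_form psi x i j.

Definition soliton (R : realType) (m n : nat) (M : riemannian R m)
    (N : riemannian R n) (psi : M -> N) (X : N -> 'rV[R]_n) (c : R) : Prop :=
  forall x : M, c *: normal_part psi x (X (psi x)) = mean_curvature psi x.

Definition gradient (R : realType) (m : nat) (M : riemannian R m)
    (f : M -> R) (x : M) : 'rV[R]_m :=
  (\row_i partial i (fun u => f (param (chart_at x) u))
            (coord (chart_at x) x)) *m invmx (metric x).

Definition warped_proj (R : realType) (I : set R) (t0 : I) (h : R -> R)
    (n : nat) (P : riemannian R n) (q : warped_product t0 h P) : R :=
  \val q.1.

(* The vector field h(t) d/dt. *)
Definition conformal_field (R : realType) (I : set R) (t0 : I) (h : R -> R)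
    (n : nat) (P : riemannian R n) (q : warped_product t0 h P) :
    'rV[R]_(1 + n) :=
  row_mx (h (warped_proj q))%:M 0.

Definition oriented_integral (R : realType) (f : R -> R) (a b : R) : R :=
  if a <= b then \int[lebesgue_measure]_(s in `[a, b]) f s
  else - \int[lebesgue_measure]_(s in `[b, a]) f s.

(* Main.v *)
(** Since [etahat' = h], the field [X = h d/dt] is the gradient of
    [etahat \o pi] on the warped product, so the gradient of [eta] on [M] is
    the tangential part of [X], while the soliton equation says that [H] is
    [c] times its normal part. By Pythagoras
    [|H|^2 + c^2 |grad eta|^2 = c^2 |X|^2 = c^2 h^2], and [h^2 = chi(etahat)] by
    the differential equation: the constant is [0]. *)
Require Import Defs.
From HB Require Import structures.
From mathcomp Require Import all_boot all_order all_algebra.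
From mathcomp Require Import all_classical all_reals all_analysis.

Set Implicit Arguments.
Unset Strict Implicit.
Unset Printing Implicit Defensive.

Import Order.TTheory GRing.Theory Num.Theory.
Import numFieldNormedType.Exports.

Local Open Scope classical_set_scope.
Local Open Scope ring_scope.

(** A nonzero vector in the left kernel of [g] would have zero square length. *)
Lemma posdef_unitmx (R : realType) (n : nat) (g : 'M[R]_n) :
  (forall v, v != 0 -> 0 < inner g v v) -> g \in unitmx.
Proof.
move=> g_pos; rewrite -row_free_unit; apply: inj_row_free => v vg0.
apply/eqP; apply/negPn/negP => /g_pos.
by rewrite /inner vg0 mul0mx mxE ltxx.
Qed.

Lemma innerZ (R : realType) (n : nat) (g : 'M[R]_n) (k : R) (v : 'rV[R]_n) :
  inner g (k *: v) (k *: v) = k ^+ 2 * inner g v v.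
Proof.
by rewrite /inner linearZ /= -scalemxAr -!scalemxAl scalerA mxE expr2.
Qed.

(** Pythagoras for the splitting along the row space of [D]: [b] solves the normal equations, so
    [v - b *m D] is [g]-orthogonal to every row of [D], and [inner G b b] is the square length of
    [b *m D]. *)
Lemma inner_normal_tangent (R : realType) (m n : nat) (g : 'M[R]_n)
    (D : 'M[R]_(m, n)) (v : 'rV[R]_n) :
  let G := D *m g *m D^T in
  let b := v *m g *m D^T *m invmx G in
  g^T = g -> G \in unitmx ->
  inner g (v - b *m D) (v - b *m D) + inner G b b = inner g v v.
Proof.
move=> G b g_sym G_unit.
have bG : b *m G = v *m g *m D^T by rewrite /b mulmxKV.
have wT : (v - b *m D) *m g *m (b *m D)^T = 0.
  rewrite trmx_mul mulmxA; apply/eqP; rewrite (_ : _ *m D^T = 0) ?mul0mx //.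
  by rewrite !mulmxBl -bG /G !mulmxA subrr.
rewrite /inner bG.
(* Both sides are 1 by 1 matrices, transposes of each other by the symmetry of [g]. *)
have -> : v *m g *m D^T *m b^T = b *m D *m g *m v^T.
  have tr11 (A : 'M[R]_1) : A^T = A by rewrite [A]mx11_scalar tr_scalar_mx.
  by rewrite -[LHS]tr11 !trmx_mul !trmxK g_sym !mulmxA.
have -> : (v - b *m D)^T = v^T - (b *m D)^T by rewrite linearB.
rewrite mulmxBr wT subr0 !mulmxBl.
set A := v *m g *m v^T; set B := b *m D *m g *m v^T.
by rewrite !mxE addrNK.
Qed.

(** Restriction to the line [s *: v + u] reduces this to the one-variable chain rule, so that
    derivability of [f] in the single direction [v] suffices. *)
Lemma derive_comp1 (R : realType) (V : normedModType R) (f : V -> R)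
    (phi : R -> R) (u v : V) :
  derivable f u v -> derivable phi (f u) 1 ->
  'D_v (phi \o f) u = derive1 phi (f u) * 'D_v f u.
Proof.
have lineE (k : V -> R) : 'D_v k u = derive1 (fun s : R => k (s *: v + u)) 0.
  rewrite /derive /derive1; set q := fun s => _; set q' := fun s => _.
  suff -> : q = q' by [].
  by apply/funext => s; rewrite /q /q' /= addr0 scale0r add0r.
move=> /derivable1P df dphi; rewrite !lineE.
have fE : f u = (fun s : R => f (s *: v + u)) 0 by rewrite scale0r add0r.
by rewrite fE in dphi *; rewrite -derive1_comp.
Qed.

(** Measuring both endpoints from a common base [a] to their left removes the case split on the
    order of [s] and [t]. *)
Lemma oriented_integralE (R : realType) (f : R -> R) (a b s t : R) :
  lebesgue_measure.-integrable `[a, b] (EFin \o f) ->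
  a <= s -> s <= b -> a <= t -> t <= b ->
  oriented_integral f s t =
  \int[lebesgue_measure]_(x in `[a, t]) f x -
  \int[lebesgue_measure]_(x in `[a, s]) f x.
Proof.
move=> f_int as_ sb at_ tb.
have diff x y : a <= x -> x <= y -> y <= b ->
    \int[lebesgue_measure]_(z in `[x, y]) f z =
    \int[lebesgue_measure]_(z in `[a, y]) f z -
    \int[lebesgue_measure]_(z in `[a, x]) f z.
  move=> ax xy yb.
  have sub c d : (BLeft a <= c)%O -> (d <= BRight b)%O ->
      lebesgue_measure.-integrable [set` Interval c d] (EFin \o f).
    by move=> ac db; apply: integrableS f_int => //; apply: subset_itv.
  rewrite Rintegral_itvB ?Rintegral_itv_obnd_cbnd ?bnd_simp //.
    by apply: sub; rewrite bnd_simp.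
  by apply: sub; rewrite bnd_simp.
rewrite /oriented_integral; case: leP => [st|/ltW ts]; first exact: diff.
by rewrite diff // opprB.
Qed.

Lemma oriented_integral_is_derive (R : realType) (I : set R) (f : R -> R)
    (s t : R) :
  open I -> is_interval I -> (forall x, I x -> {for x, continuous f}) ->
  I s -> I t ->
  is_derive t 1 (oriented_integral f s) (f t).
Proof.
move=> openI intI f_cont Is It.
have left_pt y : I y -> exists2 a, a < y & I a.
  move=> /openI/nbhs_ballP[e /= e0 sub]; exists (y - e / 2).
    by rewrite ltrBlDr ltrDl divr_gt0.
  apply: sub; rewrite /ball /= opprB addrC subrK gtr0_norm ?divr_gt0 //.
  by rewrite gtr_pMr // invf_lt1 // ltr1n.
have right_pt y : I y -> exists2 b, y < b & I b.
  move=> /openI/nbhs_ballP[e /= e0 sub]; exists (y + e / 2).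
    by rewrite ltrDl divr_gt0.
  apply: sub; rewrite /ball /= opprD addrA subrr sub0r normrN.
  by rewrite gtr0_norm ?divr_gt0 // gtr_pMr // invf_lt1 // ltr1n.
(* The segment from [a] to [b] lies in [I] and has both [s] and [t] in its interior, so the
   fundamental theorem with base [a] applies at [t]. *)
have [a a_lt Ia] : exists2 a, a < Num.min s t & I a.
  by apply: left_pt; case: leP.
have [b b_gt Ib] : exists2 b, Num.max s t < b & I b.
  by apply: right_pt; case: leP.
move: a_lt b_gt; rewrite lt_min gt_max => /andP[as_ at_] /andP[sb tb].
have f_int : lebesgue_measure.-integrable `[a, b] (EFin \o f).
  apply: continuous_compact_integrable; first exact: segment_compact.
  apply: continuous_in_subspaceT => x; rewrite inE /= in_itv /= => /andP[ax xb].
  by apply: f_cont; apply: (intI a b) => //; rewrite ax xb.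
have [F_der F'E] := continuous_FTC1_closed tb f_int at_ (f_cont _ It).
(* Near [t] the oriented integral is the integral from [a] minus a constant. *)
apply: (@near_eq_is_derive _ _ _ (fun x =>
  \int[lebesgue_measure]_(z in `[a, x]) f z -
  \int[lebesgue_measure]_(z in `[a, s]) f z)).
  near=> x; rewrite (@oriented_integralE _ _ a b) //; try exact: ltW.
    by apply/ltW; near: x; exact: lt_nbhsr.
  by apply/ltW; near: x; exact: lt_nbhsl.
rewrite -[f t]subr0 -F'E derive1E; apply: is_deriveB.
by apply: DeriveDef.
Unshelve. all: by end_near. Qed.

(** Isometry tested on coordinate vectors; it identifies the Gram matrix inverted in [tangent_part]
    with the metric of [M]. *)
Lemma isometric_gram (R : realType) (m n : nat) (M : riemannian R m)
    (N : riemannian R n) (psi : M -> N) (x : M) :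
  isometric_immersion psi ->
  dmap psi x *m metric (psi x) *m (dmap psi x)^T = metric x.
Proof.
move=> psi_isom; apply/matrixP => i j.
have := immersion_isometric psi_isom x (delta_mx 0 i) (delta_mx 0 j).
have entryE (k : nat) (A : 'M[R]_k) (a b : 'I_k) :
    inner A (delta_mx 0 a) (delta_mx 0 b) = A a b.
  by rewrite /inner -rowE trmx_delta -colE !mxE.
rewrite entryE => <-; rewrite -entryE /inner trmx_mul.
by rewrite !mulmxA.
Qed.

(** The metric is block diagonal with entry 1 in the [t] direction, the only direction in which the
    field has a component. *)
Lemma conformal_fieldE (R : realType) (I : set R) (t0 : I) (h : R -> R)
    (n m : nat) (P : riemannian R n) (q : warped_product t0 h P)
    (D : 'M[R]_(m, 1 + n)) :
  conformal_field q *m metric q *m D^T =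
  \row_i (h (warped_proj q) * D i (lshift n 0)).
Proof.
rewrite /conformal_field /= mul_row_block mulmx1 !mulmx0 !mul0mx !addr0.
apply/rowP => i; rewrite !mxE big_split_ord /= [X in _ + X]big1 ?addr0.
  rewrite big_ord1 row_mxEl !mxE eqxx mulr1n.
  by congr (_ * D i _); apply: val_inj.
by move=> j _; rewrite row_mxEr mxE mul0r.
Qed.

Lemma inner_conformal_field (R : realType) (I : set R) (t0 : I) (h : R -> R)
    (n : nat) (P : riemannian R n) (q : warped_product t0 h P) :
  inner (metric q) (conformal_field q) (conformal_field q) =
  h (warped_proj q) ^+ 2.
Proof.
by rewrite /inner conformal_fieldE mxE row_mxEl mxE eqxx mulr1n expr2.
Qed.

(** By the chain rule the partial derivatives of the composite are [h] times those of the [t]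
    component of [psi], which are the products of the conformal field with the rows of
    [dmap psi x]. *)
Lemma gradient_warped (R : realType) (m n : nat) (I : set R) (t0 : I)
    (h phi : R -> R) (P : riemannian R n) (M : riemannian R m)
    (psi : M -> warped_product t0 h P) (x : M) :
  is_riemannian_manifold P -> is_riemannian_manifold M ->
  smooth_between psi ->
  is_derive (warped_proj (psi x)) 1 phi (h (warped_proj (psi x))) ->
  gradient (fun y => phi (warped_proj (psi y))) x =
  conformal_field (psi x) *m metric (psi x) *m (dmap psi x)^T *m
    invmx (metric x).
Proof.
move=> P_riem M_riem [_ psi_smooth] phi_der.
have [Ma Mx] := manifold_chart_at M_riem x.
have [Pa Px] := manifold_chart_at P_riem (psi x).2.
rewrite /gradient conformal_fieldE; congr (_ *m _).
apply/rowP => i; rewrite !mxE.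
set u := Defs.coord (chart_at x) x.
have uK : param (chart_at x) u = x by have [_ _ ->] := manifold_chart M_riem Ma.
pose f (v : 'rV[R]_m) : R := warped_proj (psi (param (chart_at x) v)).
(* Warped charts keep [t] as their first coordinate. *)
have fE : f = fun v => local_rep psi x v 0 (lshift n 0).
  by apply/funext => v; rewrite /local_rep /= row_mxEl mxE eqxx mulr1n.
have fu : f u = warped_proj (psi x) by rewrite /f uK.
have f_der : derivable f u (delta_mx 0 i).
  have Na : atlas (warped_product t0 h P) (chart_at (psi x)).
    by exists (chart_at (psi x).2).
  have [_ /(_ i)[+ _]] := psi_smooth _ _ Ma Na (lshift n 0) 1%N.
  by rewrite fE; apply; exists x.
rewrite -fu in phi_der *.
have phi_dv : derivable phi (f u) 1 by case: phi_der.
have phiE : derive1 phi (f u) = h (f u) by rewrite derive1E; case: phi_der.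
by rewrite /partial (derive_comp1 f_der phi_dv) phiE fE.
Qed.

Theorem proposition6p4 (R : realType) (m n : nat)
    (I : set R) (openI : open I) (intervalI : is_interval I) (t0 : I)
    (h : R -> R)
    (h_gt0 : forall t, I t -> 0 < h t)
    (h_smooth : forall (k : nat) t, I t -> derivable (h^`(k))%classic t 1)
    (P : riemannian R n) (P_riem : is_riemannian_manifold P)
    (M : riemannian R m) (M_riem : is_riemannian_manifold M)
    (M_connected : connected [set: M])
    (psi : M -> warped_product t0 h P)
    (psi_isom : isometric_immersion psi)
    (c : R)
    (psi_soliton : soliton psi (@conformal_field R I t0 h n P) c)
    (etahat := fun t : R => oriented_integral h (\val t0) t)
    (eta := fun x : M => etahat (warped_proj (psi x)))
    (chi : R -> R)
    (chi_derivable : forall s, derivable chi s 1)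
    (chi_C1 : continuous (chi^`())%classic)
    (chi_ge0 : forall s, (etahat @` I) s -> 0 <= chi s)
    (etahat_ode : forall t, I t -> (etahat^`())%classic t = Num.sqrt (chi (etahat t))) :
  exists C : R, forall x : M,
    let H := mean_curvature psi x in
    let grad_eta := gradient eta x in
    inner (metric (psi x)) H H + c ^+ 2 * inner (metric x) grad_eta grad_eta
      - c ^+ 2 * chi (eta x) = C.
Proof.
exists 0 => x /=.
have Ix : I (warped_proj (psi x)) by exact: set_valP.
have h_cont t : I t -> {for t, continuous h}.
  move=> It; apply: differentiable_continuous; apply/derivable1_diffP.
  exact: (h_smooth 0%N).
have etahat_der :
    is_derive (warped_proj (psi x)) 1 etahat (h (warped_proj (psi x))).
  by apply: (oriented_integral_is_derive openI intervalI) => //; exact: set_valP.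
(* Both [h] and the square root of [chi] are the derivative of [etahat]; as [Num.sqrt] vanishes on
   negative numbers, squaring it back relies on [chi_ge0]. *)
have h2 : h (warped_proj (psi x)) ^+ 2 = chi (eta x).
  have <- : derive1 etahat (warped_proj (psi x)) = h (warped_proj (psi x)).
    by rewrite derive1E; case: etahat_der.
  by rewrite etahat_ode // sqr_sqrtr //; apply: chi_ge0;
    exists (warped_proj (psi x)).
have gram := isometric_gram x psi_isom.
have metric_unit : metric x \in unitmx.
  by apply: posdef_unitmx; exact: (metric_posdef M_riem).
have N_sym : (metric (psi x))^T = metric (psi x).
  by rewrite /= tr_block_mx !trmx0 trmx1 linearZ /= (Defs.metric_sym P_riem).
rewrite -psi_soliton innerZ /eta.
rewrite (gradient_warped P_riem M_riem (immersion_smooth psi_isom) etahat_der).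
(* With [c ^+ 2] factored out and [metric x] read as the Gram matrix, the bracket is the left side
   of [inner_normal_tangent]. *)
rewrite -mulrDr /normal_part /tangent_part.
rewrite -gram inner_normal_tangent ?gram //.
by rewrite inner_conformal_field h2 subrr.
Qed.
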